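(* Let $\mathcal H$ be an infinite-dimensional separable Hilbert space. Assume that the frame $\{f_k\}_{k=1}^\infty$ for $\mathcal H$ has a representation $\{f_k\}_{k=1}^\infty=\{T^nf_1\}_{n=0}^\infty$ (i.e. $f_{n+1}=T^nf_1$ for all $n\ge0$), where $T:\mathcal H\to\mathcal H$ is a bounded linear operator. Choose $\ell,\ell'\in\mathbb N$ with $\ell\ne\ell'$ such that $$\overline{\mathrm{span}}\{f_k\}_{k\notin\{\ell-1,\ell,\ell'-1,\ell'\}}=\mathcal H,$$ and let $\{\widetilde{f_k}\}_{k=1}^\infty$ denote the sequence consisting of the same elements as $\{f_k\}_{k=1}^\infty$ but with $f_\ell$ and $f_{\ell'}$ interchanged. Then $\{\widetilde{f_k}\}_{k=1}^\infty$ is not representable by a bounded operator, i.e. there is no bounded linear operator $W:\mathcal H\to\mathcal H$ such that $\widetilde{f}_{n+1}=W^n\widetilde{f_1}$ for all $n\ge0$.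
   Context: $\mathbb N=\{1,2,3,\dots\}$, and $\overline{\mathrm{span}}$ denotes the closed linear span; the index $k$ ranges over $\mathbb N$. A sequence $\{f_k\}_{k=1}^\infty$ in $\mathcal H$ is a frame for $\mathcal H$ if there exist constants $A,B>0$ such that $A\|f\|^2\le\sum_{k=1}^\infty|\langle f,f_k\rangle|^2\le B\|f\|^2$ for all $f\in\mathcal H$. *)

(* Defs.v *)
From HB Require Import structures.
From mathcomp Require Import all_boot all_order all_algebra.
From mathcomp Require Import complex.
From mathcomp Require Import all_classical all_reals all_analysis.
Set Implicit Arguments.
Unset Strict Implicit.
Unset Printing Implicit Defensive.
Import Order.TTheory GRing.Theory Num.Theory.
Import numFieldNormedType.Exports.
Local Open Scope classical_set_scope.
Local Open Scope ring_scope.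

Variant scalar_kind := RealScalars | ComplexScalars.

Definition scalars (R : realType) (s : scalar_kind) : numFieldType :=
  match s with
  | RealScalars => R : numFieldType
  | ComplexScalars => R[i] : numFieldType
  end.

Definition scalar_conj (R : realType) (s : scalar_kind) :
    scalars R s -> scalars R s :=
  match s return scalars R s -> scalars R s with
  | RealScalars => fun x => x
  | ComplexScalars => fun z : R[i] => Num.conj z
  end.

(* A Hilbert space is a complete normed module whose norm is the one of the
   inner product [inner], which is linear in its first argument. *)
Record hilbertType (R : realType) (s : scalar_kind) := HilbertType {
  hilbert_sort :> completeNormedModType (scalars R s);
  inner : {dot hilbert_sort for @scalar_conj R s};
  inner_norm : forall x : hilbert_sort, `|x| ^+ 2 = inner x x }.

Definition separable_space (T : topologicalType) : Prop :=
  exists D : set T, countable D /\ dense D.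

Definition linear_span (K : numFieldType) (V : lmodType K) (S : set V) : set V :=
  [set x | exists (n : nat) (c : 'I_n -> K) (v : 'I_n -> V),
     (forall i, S (v i)) /\ x = \sum_(i < n) c i *: v i].

Definition closed_span (K : numFieldType) (V : normedModType K) (S : set V) :
    set V :=
  closure (linear_span S).

Definition infinite_dimensional (K : numFieldType) (V : lmodType K) : Prop :=
  ~ exists S : set V, finite_set S /\ linear_span S = setT.

Definition bounded_operator (K : numFieldType) (V : normedModType K)
    (T : {linear V -> V}) : Prop :=
  exists M : K, forall x : V, `|T x| <= M * `|x|.

(* Sequences f_1, f_2, ... are functions on nat whose value at 0 is never used.
   When the scalars are complex, the order of R[i] is partial: [0 < A] says
   that A is a positive real, and the two bounds compare nonnegative reals. *)
Definition is_frame (R : realType) (s : scalar_kind) (H : hilbertType R s)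
    (f : nat -> H) : Prop :=
  exists A B : scalars R s, [/\ 0 < A, 0 < B &
    forall x : H, exists2 S : scalars R s,
      (fun n => \sum_(1 <= k < n.+1) `|inner H x (f k)| ^+ 2) @ \oo --> S &
      A * `|x| ^+ 2 <= S /\ S <= B * `|x| ^+ 2].

Definition represented_by (V : Type) (f : nat -> V) (T : V -> V) : Prop :=
  forall n : nat, f n.+1 = iter n T (f 1%N).

Definition interchange_terms (V : Type) (f : nat -> V) (l l' : nat) : nat -> V :=
  fun k => if k == l then f l' else if k == l' then f l else f k.

(* Main.v *)
Require Import Defs.
From mathcomp Require Import all_boot all_order all_algebra.
From mathcomp Require Import all_classical all_reals all_analysis.
Set Implicit Arguments.
Unset Strict Implicit.
Unset Printing Implicit Defensive.
Import numFieldNormedType.Exports.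
Local Open Scope classical_set_scope.
Local Open Scope ring_scope.
Import Order.TTheory GRing.Theory Num.Theory.

(** The interchanged sequence g agrees with f, together with its successor,
    at every index k outside {l-1, l, l'-1, l'}, so an operator W whose orbit
    is g satisfies W f_k = g_(k+1) = f_(k+1) = T f_k for these k. Their span
    is dense and both operators are continuous, hence W = T
    ([bounded_operators_eq_on_dense]). So g itself is an orbit of T.

    Say l < l'. Applying T to g_l = f_l' gives f_(l'+1) = g_(l+1), and g_(l+1)
    is f_(l+1), or f_l when l' = l+1: in both cases f_(l'+1) is an earlier
    term of f ([interchanged_orbit_revisits]). An orbit that returns to an
    earlier term has finitely many values ([orbit_finite_range]).

    A frame with finitely many values forces finite dimension
    ([frame_finite_range_spanned]): by the lower frame bound, a vector
    orthogonal to all these values is zero, so finitely many linear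
    functionals separate the points of the space. This contradicts the
    assumption of infinite dimension. *)

Lemma linear_span_addZ (K : numFieldType) (V : lmodType K) (S : set V)
    (e y : V) (a : K) :
  linear_span S y -> linear_span (e |` S) (a *: e + y).
Proof.
move=> [n [c [v [Sv ->]]]].
exists n.+1, (fun i => oapp c a (unlift ord0 i)).
exists (fun i => oapp v e (unlift ord0 i)); split.
  by move=> i; case: unliftP => [j _|_] /=; [right | left].
rewrite big_ord_recl unlift_none /=; congr (_ + _).
by apply: eq_bigr => i _; rewrite liftK.
Qed.

(** By induction on the number of functionals: when [phi n] is not a
    consequence of the previous ones, there is a vector [e] killed by those
    and not by [phi n], and adding a multiple of [e] corrects the value of
    [phi n] without changing the others. *)
Lemma finite_span_interpolation (K : numFieldType) (V : lmodType K)
    (phi : nat -> {scalar V}) (n : nat) :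
  exists2 S : set V, finite_set S &
    forall x, exists2 y, linear_span S y &
      forall i, (i < n)%N -> phi i y = phi i x.
Proof.
elim: n => [|n [S finS IH]].
  exists set0 => // x; exists 0 => //.
  by exists 0%N, (fun=> 0), (fun=> 0); split=> [[]|] //; rewrite big_ord0.
have [[e e0 en]|noe] :=
  pselect (exists2 e, forall i, (i < n)%N -> phi i e = 0 & phi n e != 0).
  exists (e |` S); first by rewrite finite_setU; split.
  move=> x; have [y Sy yx] := IH x.
  exists (((phi n x - phi n y) / phi n e) *: e + y).
    exact: linear_span_addZ.
  move=> i; rewrite ltnS leq_eqVlt linearP => /orP[/eqP->|ilt].
    by rewrite /= divfK// subrK.
  by rewrite (e0 i)// (yx i)// mulr0 add0r.
exists S => // x; have [y Sy yx] := IH x; exists y => // i.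
rewrite ltnS leq_eqVlt => /orP[/eqP->|]; last exact: yx.
apply/eqP; rewrite -subr_eq0 -linearB; apply: contra_notT noe => neq.
by exists (y - x) => // j jn; rewrite linearB /= yx// subrr.
Qed.

Lemma separating_functionals_spanned (K : numFieldType) (V : lmodType K)
    (phi : nat -> {scalar V}) (n : nat) :
  (forall x, (forall i, (i < n)%N -> phi i x = 0) -> x = 0) ->
  exists S : set V, finite_set S /\ linear_span S = setT.
Proof.
move=> sep; have [S finS interp] := finite_span_interpolation phi n.
exists S; split=> //; apply/seteqP; split=> // x _.
have [y Sy yx] := interp x.
suff -> : x = y by [].
by apply/subr0_eq/sep => i ilt; rewrite linearB /= yx// subrr.
Qed.

Lemma bounded_operator_continuous (K : numFieldType) (V : normedModType K)
    (T : {linear V -> V}) :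
  bounded_operator T -> continuous T.
Proof.
move=> [M TM]; apply/linear_bounded_continuous/linear_boundedP.
(* When V is trivial, M may fail to be real and then lies below no scalar near
   +oo; `|M| is real and is a bound as well. *)
have TnM x : `|T x| <= `|M| * `|x|.
  have Mx0 : 0 <= M * `|x| by apply: le_trans (TM x).
  by rewrite -[`|x|]normr_id -normrM (ger0_norm Mx0).
near=> r => x; apply: le_trans (TnM x) _; apply: ler_wpM2r; first by [].
by near: r; apply: nbhs_pinfty_ge; rewrite realE normr_ge0.
Unshelve. all: by end_near. Qed.

Lemma bounded_operators_eq_on_dense (K : numFieldType) (V : normedModType K)
    (T W : {linear V -> V}) (S : set V) :
  bounded_operator T -> bounded_operator W -> closed_span S = setT ->
  (forall x, S x -> W x = T x) -> W =1 T.
Proof.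
move=> /bounded_operator_continuous cT /bounded_operator_continuous cW.
move=> denseS WT.
pose E := (fun x => W x - T x) @^-1` [set 0].
have closedE : closed E.
  apply: preimage_closed; first by move=> x _; exact: (cvgB (cW x) (cT x)).
  exact/accessible_closed_set1/hausdorff_accessible/norm_hausdorff.
have spanE : linear_span S `<=` E.
  move=> _ [n [c [v [Sv ->]]]]; apply/eqP; rewrite subr_eq0 !linear_sum.
  by apply/eqP/eq_bigr => i _; rewrite !linearZ /= WT.
move=> x; apply: subr0_eq.
have : closed_span S x by rewrite denseS.
by move=> /(closureS spanE); rewrite -((closure_id E).1 closedE).
Qed.

Lemma represented_by_step (V : Type) (f : nat -> V) (T : V -> V) (k : nat) :
  represented_by f T -> (0 < k)%N -> f k.+1 = T (f k).
Proof. by move=> fT; case: k => // k _; rewrite fT iterS -fT. Qed.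

Lemma orbit_finite_range (V : Type) (f : nat -> V) (T : V -> V) (m q : nat) :
  represented_by f T -> (0 < m < q)%N -> f q = f m ->
  forall k, (0 < k)%N -> exists2 i, (0 < i < q)%N & f k = f i.
Proof.
move=> fT /andP[m0 mq] fqm; elim=> // k IH _.
have [k0|k0] := posnP k; first by exists 1%N; rewrite ?k0//= (leq_ltn_trans m0).
have [i /andP[i0 iq] fki] := IH k0.
have fk1 : f k.+1 = f i.+1 by rewrite !(represented_by_step fT)// fki.
have [i1q|iq'] := ltnP i.+1 q; first by exists i.+1.
(* The shift from i leaves the range only at q, where f takes the value f m. *)
exists m; first by rewrite m0.
by rewrite fk1 -fqm; congr f; apply/eqP; rewrite eqn_leq iq iq'.
Qed.

Lemma interchange_termsC (V : Type) (f : nat -> V) (l l' : nat) :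
  interchange_terms f l l' =1 interchange_terms f l' l.
Proof.
by move=> k; rewrite /interchange_terms; do 2 case: eqP => //; move=> -> ->.
Qed.

(** The step from index l compares two orbits of T: f_l' sits at position l
    of the interchanged sequence, so its successor f_(l'+1) sits at position
    l+1, where f_(l+1) or, for adjacent indices, f_l is found. *)
Lemma interchanged_orbit_revisits (V : Type) (f : nat -> V) (T : V -> V)
    (l l' : nat) :
  (0 < l < l')%N -> represented_by f T ->
  (forall k, (0 < k)%N ->
    interchange_terms f l l' k.+1 = T (interchange_terms f l l' k)) ->
  exists2 m, (0 < m < l'.+1)%N & f l'.+1 = f m.
Proof.
move=> /andP[l0 ll'] fT gT; have := gT l l0.
rewrite /interchange_terms eqxx -(represented_by_step fT); last first.
  exact: ltn_trans ll'.
rewrite gtn_eqF//; case: eqP => [_ <-|_ <-].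
  by exists l; rewrite // l0 ltnW.
by exists l.+1; rewrite // ltnS.
Qed.

Lemma frame_orthogonal_eq0 (R : realType) (s : scalar_kind)
    (H : hilbertType R s) (f : nat -> H) (x : H) :
  is_frame f -> (forall k, (0 < k)%N -> inner H x (f k) = 0) -> x = 0.
Proof.
move=> [A [B [A0 B0 bounds]]] xf; have [S cvgS [AS _]] := bounds x.
have S0 : S = 0.
  have sum0 n : \sum_(1 <= k < n.+1) `|inner H x (f k)| ^+ 2 = 0.
    by rewrite big_nat big1// => k /andP[k0 _]; rewrite xf// normr0 expr0n.
  move: cvgS; under eq_fun do rewrite sum0.
  by move=> cvgS; apply: (cvg_unique _ cvgS); [exact: norm_hausdorff|exact: cvg_cst].
move: AS; rewrite S0 pmulr_rle0// => x2.
apply/eqP; rewrite -normr_eq0 -sqrf_eq0.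
by rewrite eq_le x2 exprn_ge0.
Qed.

(** Reduces infinitely many orthogonality conditions to finitely many: the
    functionals given by the values of f separate points by the lower frame
    bound. *)
Lemma frame_finite_range_spanned (R : realType) (s : scalar_kind)
    (H : hilbertType R s) (f : nat -> H) (q : nat) :
  is_frame f ->
  (forall k, (0 < k)%N -> exists2 i, (0 < i < q)%N & f k = f i) ->
  exists S : set H, finite_set S /\ linear_span S = setT.
Proof.
move=> frame_f range_f.
pose phi k : {scalar H} := applyr (inner H) (f k).
apply: (@separating_functionals_spanned _ _ phi q) => x x0.
apply: (frame_orthogonal_eq0 frame_f) => k /range_f[i /andP[_ iq] ->].
exact: x0.
Qed.

Theorem corollary2p9 (R : realType) (s : scalar_kind) (H : hilbertType R s)
    (H_separable : separable_space H)
    (H_infinite : infinite_dimensional H)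
    (f : nat -> H) (f_frame : is_frame f)
    (T : {linear H -> H}) (T_bounded : bounded_operator T)
    (f_T : represented_by f T)
    (l l' : nat) (l_ge1 : (1 <= l)%N) (l'_ge1 : (1 <= l')%N) (l_neq : l <> l')
    (f_span : closed_span
       [set f k | k in [set k : nat | (1 <= k)%N /\
                          k \notin [:: l.-1; l; l'.-1; l']]] = setT) :
  ~ exists W : {linear H -> H},
      bounded_operator W /\ represented_by (interchange_terms f l l') W.
Proof.
move=> [W [W_bounded g_W]].
have WT : W =1 T.
  apply: (bounded_operators_eq_on_dense T_bounded W_bounded f_span).
  move=> _ [k [k0 kl] <-]; rewrite -(represented_by_step f_T)//.
  move: kl; rewrite !inE !negb_or => /and4P[/negPf kl1 /negPf kl /negPf kl'1].
  move=> /negPf kl'; have := represented_by_step g_W k0.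
  have shift j : (0 < j)%N -> (k.+1 == j) = (k == j.-1) by case: j.
  by rewrite /interchange_terms !shift// kl1 kl kl'1 kl'.
have g_T k : (0 < k)%N ->
    interchange_terms f l l' k.+1 = T (interchange_terms f l l' k).
  by move=> k0; rewrite (represented_by_step g_W).
have [m [q mq fqm]] : exists m, exists2 q, (0 < m < q)%N & f q = f m.
  have [ll'|l'l|//] := ltngtP l l'.
    have [|m ml' fm] := @interchanged_orbit_revisits _ f T l l' _ f_T g_T.
      by rewrite l_ge1.
    by exists m, l'.+1.
  have [||m ml fm] := @interchanged_orbit_revisits _ f T l' l _ f_T.
  - by rewrite l'_ge1.
  - by move=> k k0; rewrite !(interchange_termsC f l' l) g_T.
  by exists m, l.+1.
apply: H_infinite; apply: (frame_finite_range_spanned (q := q) f_frame).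
exact: orbit_finite_range f_T mq fqm.
Qed.
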